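(* Let $\Gamma\subset\mathbb{R}^n$ be a graph consisting of arcs $a_1,\dots,a_N$, and let $p\in\mathbb{R}^n\setminus\Gamma$. Then $$2\pi\Theta_{C_p(\Gamma)}(p)=-\sum_{k=1}^N\int_{a_k}\vec{k}\cdot\nu_C\,ds+\sum_{k=1}^N\sum_{j=1,2}\left(\frac{\pi}{2}-\beta^k_j\right)\le\mathcal{C}_{\rm tot}(\Gamma),$$ where $\vec{k}$ is the geodesic curvature vector of $a_k$ in $\mathbb{R}^n$, $\nu_C$ is the outward unit normal vector at $a_k\subset\partial C_p(\Gamma)$, and $\beta^k_j$ ($j=1,2$) is the angle between the tangent vector to $a_k$ at its $j$-th endpoint $q$ and the line segment from $q$ to $p$.
   Context: Graph: $\Gamma$ is a finite graph, the union of finitely many immersed arcs meeting at vertices; each arc is $C^2$ in its interior and $C^1$ up to its end points, and each vertex has valence at least two (valence = number of times the vertex occurs as an endpoint of the arcs). Tangent vectors to an arc at an endpoint are taken to be unit vectors pointing into the arc. Cone: $C_p(\Gamma)=\{p+t(x-p):x\in\Gamma,\ 0\le t\le1\}$, regarded as the union, with multiplicity, of the fans $C_p(a_k)$. Its density at $p$ is $\Theta_{C_p(\Gamma)}(p)=\lim_{\varepsilon\to0}\frac{\mathrm{Length}(C_p(\Gamma)\cap\partial B_\varepsilon(p))}{2\pi\varepsilon}$, counted with multiplicity; equivalently $2\pi\Theta_{C_p(\Gamma)}(p)$ is the length, counted with multiplicity, of the radial projection of $\Gamma$ to the unit sphere centered at $p$. $\nu_C(q)$ is the unit vector normal to $\Gamma$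 at $q$, in the plane spanned by the tangent vector to $\Gamma$ at $q$ and the vector $p-q$, pointing away from $p$ (defined at points where $\Gamma$ is not tangent to the line through $p$; take $\nu_C=0$ elsewhere). Total curvature: for a vertex $q$ of valence $d$ with unit tangent vectors $T_1,\dots,T_d$ to the arcs at $q$, $\mathrm{tc}(q)=\sup_{e}\sum_{\ell=1}^d\left(\frac{\pi}{2}-\beta_\ell(e)\right)$, the supremum over unit vectors $e$, where $\beta_\ell(e)\in[0,\pi]$ is the angle between $T_\ell$ and $e$. Then $\mathcal{C}_{\rm tot}(\Gamma)=\int_{\Gamma^{\rm reg}}|\vec{k}|\,ds+\sum\{\mathrm{tc}(q):q\text{ a vertex of }\Gamma\}$, where $\Gamma^{\rm reg}=\Gamma\setminus\{\text{vertices}\}$. *)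

(* Defs.v *)
From HB Require Import structures.
From mathcomp Require Import all_boot all_order all_algebra.
From mathcomp Require Import all_classical all_reals all_analysis.

Set Implicit Arguments.
Unset Strict Implicit.
Unset Printing Implicit Defensive.

Import Order.TTheory GRing.Theory Num.Theory.
Import numFieldNormedType.Exports.

Local Open Scope classical_set_scope.
Local Open Scope ring_scope.

Section Euclidean.
Context {R : realType} {n : nat}.
Implicit Types u v : 'rV[R]_n.

Definition dot u v : R := \sum_(i < n) u ord0 i * v ord0 i.

(* The norm `|u| of the library on 'rV[R]_n is the sup norm; it induces the
   same topology and the same derivatives, but lengths need this one. *)
Definition enorm u : R := Num.sqrt (dot u u).

(* normalize 0 = 0. *)
Definition normalize u : 'rV[R]_n := (enorm u)^-1 *: u.

Definition angle u v : R := acos (dot u v / (enorm u * enorm v)).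

End Euclidean.

(* C^1 with nonvanishing velocity on [0, 1], C^2 on ]0, 1[.
   On [0, 1] the field [vel] is determined by [pos]: it is the continuous
   extension to [0, 1] of the derivative of [pos] on ]0, 1[. The values of
   [pos] and [vel] outside [0, 1] are irrelevant. *)
Record immersed_arc (R : realType) (n : nat) := ImmersedArc {
  pos : R -> 'rV[R]_n;
  vel : R -> 'rV[R]_n;
  pos_continuous : {within `[0, 1], continuous pos};
  vel_continuous : {within `[0, 1], continuous vel};
  pos_derive : forall t : R, t \in `]0, 1[ -> is_derive t 1 pos (vel t);
  vel_derivable : forall t : R, t \in `]0, 1[ -> derivable vel t 1;
  acc_continuous :
    forall t : R, t \in `]0, 1[ -> {for t, continuous (derive1 vel)};
  vel_neq0 : forall t : R, t \in `[0, 1] -> vel t != 0 }.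

Section Arc.
Context {R : realType} {n : nat}.
Implicit Types (a : immersed_arc R n) (p : 'rV[R]_n).

Definition speed a (t : R) : R := enorm (vel a t).

Definition tangent a (t : R) : 'rV[R]_n := normalize (vel a t).

(* The curvature vector dT/ds, where ds = speed dt. *)
Definition curvature a (t : R) : 'rV[R]_n :=
  (speed a t)^-1 *: derive1 (tangent a) t.

(* The component of q - p orthogonal to the tangent, normalized: the unit
   normal in the plane of the tangent and p - q that points away from p. It
   is 0 when the tangent line passes through p. *)
Definition nuC a p (t : R) : 'rV[R]_n :=
  let w := pos a t - p in normalize (w - dot w (tangent a t) *: tangent a t).

(* The end points are indexed by bool: false for t = 0, true for t = 1. *)
Definition arc_end a (j : bool) : 'rV[R]_n := pos a (if j then 1 else 0).

Definition end_tangent a (j : bool) : 'rV[R]_n :=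
  if j then - tangent a 1 else tangent a 0.

Definition beta a p (j : bool) : R :=
  angle (end_tangent a j) (p - arc_end a j).

Definition subarc_integral a (f : R -> R) (I : R * R) : R :=
  \int[@lebesgue_measure R]_(t in `[I.1, I.2]) (f t * speed a t).

(* Second derivatives may blow up at the end points, so that k . nu_C need not
   be absolutely integrable along the arc: integrals of signed functions along
   an arc are limits of Lebesgue integrals over compact subarcs, with the two
   end points approached independently. For f integrable along the arc this is
   the Lebesgue integral. *)
Definition arc_ends : set_system (R * R) := filter_prod 0^'+ 1^'-.

Definition arc_integrable a (f : R -> R) : Prop :=
  cvg (subarc_integral a f @ arc_ends).

Definition arc_integral a (f : R -> R) : R :=
  lim (subarc_integral a f @ arc_ends).

Definition fan a p (s t : R) : 'rV[R]_n := p + s *: (pos a t - p).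

(* fan a p s t lies on the sphere of radius eps about p exactly when s is
   this parameter. *)
Definition slice_param a p (eps t : R) : R := eps / enorm (pos a t - p).

Definition slice a p (eps t : R) : 'rV[R]_n :=
  fan a p (slice_param a p eps t) t.

(* The parameters t of the points x of the arc whose ray meets the sphere of
   radius eps about p inside the fan, that is, for s in [0, 1]. *)
Definition slice_domain a p (eps : R) : set R :=
  [set t | (t \in `]0, 1[) && (slice_param a p eps t <= 1)].

(* The length, counted with multiplicity, of the intersection of the fan over
   the arc with the sphere of radius eps about p. *)
Definition slice_length a p (eps : R) : R :=
  \int[@lebesgue_measure R]_(t in slice_domain a p eps)
    enorm (derive1 (slice a p eps) t).

End Arc.

Section Graph.
Context {R : realType} {n N : nat}.
Implicit Types (a : 'I_N -> immersed_arc R n) (p q : 'rV[R]_n).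

Definition graph_support a : set 'rV[R]_n :=
  [set x | exists k, exists2 t : R, t \in `[0, 1] & pos (a k) t = x].

(* The ends of arcs, as pairs (arc, side). *)
Definition endpoint a (i : 'I_N * bool) : 'rV[R]_n := arc_end (a i.1) i.2.

Definition valence a q : nat := #|[pred i : 'I_N * bool | endpoint a i == q]|.

Definition vertices a : seq 'rV[R]_n :=
  undup [seq endpoint a i | i : 'I_N * bool].

Definition is_graph a : Prop := {in vertices a, forall q, (2 <= valence a q)%N}.

Definition tc a q : R :=
  sup [set \sum_(i : 'I_N * bool | endpoint a i == q)
             (pi / 2 - angle (end_tangent (a i.1) i.2) e)
      | e in [set e : 'rV[R]_n | enorm e = 1]].

(* The parameters of the points of arc k that lie in the graph minus its
   vertices. *)
Definition regular_part a (k : 'I_N) : set R :=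
  [set t | (t \in `]0, 1[) && (pos (a k) t \notin vertices a)].

(* Infinite when the curvature is not integrable. *)
Definition total_curvature a : \bar R :=
  (\sum_(k < N) \int[@lebesgue_measure R]_(t in regular_part a k)
      (enorm (curvature (a k) t) * speed (a k) t)%:E
   + (\sum_(q <- vertices a) tc a q)%:E)%E.

Definition cone_density_ratio a p (eps : R) : R :=
  (\sum_(k < N) slice_length (a k) p eps) / (2 * pi * eps).

Definition cone_density a p : R := lim (cone_density_ratio a p @ 0^'+).

End Graph.

(* Main.v *)
Require Import Defs.
From HB Require Import structures.
From mathcomp Require Import all_boot all_order all_algebra.
From mathcomp Require Import all_classical all_reals all_analysis.
From mathcomp Require Import measurable_realfun ring lra.

Set Implicit Arguments.
Unset Strict Implicit.
Unset Printing Implicit Defensive.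

Import Order.TTheory GRing.Theory Num.Theory.
Import numFieldNormedType.Exports.

Local Open Scope classical_set_scope.
Local Open Scope ring_scope.

(** Fix one arc, and let [u] be its radial projection to the unit sphere
    centered at [p], [T] its unit tangent and [phi] the angle between [T] and [u].
    Spheres about [p] that are small enough cut the cone over the arc in a curve
    of length [eps] times the length of [u] ([slice_lengthE]); so [2 pi] times
    the density is the sum of the lengths of the radial projections
    ([cone_density_cvg]).

    Differentiating [cos phi = T . u] gives, for the parameter of the arc,
    [|u'| = - k . nuC ds/dt - phi'] ([derive_ray_cosineE]). Integrating,
    the length of [u] is minus the integral of [k . nuC] plus
    [phi 0 - phi 1], and the latter is the sum of [pi / 2 - beta] over the two
    ends ([sum_beta]).

    Two points need care. First, [phi] need not be differentiable where the arc
    is tangent to the line through [p]. It is locally Lipschitz though, and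
    [integral_derive_acos] proves the fundamental theorem of calculus for it by
    replacing [cos phi] with [l cos phi] and letting [l] increase to [1].
    Secondly, the curvature may fail to be integrable near the end points. But
    [phi] and the length of [u] are continuous on the closed arc, so the
    integrals over compact subarcs have a limit ([arc_integral_cvg]).

    For the inequality, [- k . nuC <= |k|] bounds the curvature term
    ([opp_arc_integral_le]), where the interior parameters at which an arc meets
    a vertex are countably many because arcs are immersed
    ([integral_regular_part]). The angle terms are grouped by vertices; at a
    vertex [q] they sum to the expression whose supremum over unit vectors [e]
    is [tc a q], taken at the direction [e] from [q] to [p] ([le_tc]). *)

(** * Orthogonal components, cosines, and their derivatives *)

Section DotProduct.
Context {R : realType} {n : nat}.
Implicit Types u v w x : 'rV[R]_n.

Lemma dotC u v : dot u v = dot v u.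
Proof. by apply: eq_bigr => i _; rewrite mulrC. Qed.

Lemma dotDl u v w : dot (u + v) w = dot u w + dot v w.
Proof. by rewrite -big_split; apply: eq_bigr => i _; rewrite mxE mulrDl. Qed.

Lemma dotZl c u v : dot (c *: u) v = c * dot u v.
Proof. by rewrite mulr_sumr; apply: eq_bigr => i _; rewrite mxE mulrA. Qed.

Lemma dotNl u v : dot (- u) v = - dot u v.
Proof. by rewrite -scaleN1r dotZl mulN1r. Qed.

Lemma dotBl u v w : dot (u - v) w = dot u w - dot v w.
Proof. by rewrite dotDl dotNl. Qed.

Lemma dotDr u v w : dot u (v + w) = dot u v + dot u w.
Proof. by rewrite !(dotC u) dotDl. Qed.

Lemma dotZr c u v : dot u (c *: v) = c * dot u v.
Proof. by rewrite !(dotC u) dotZl. Qed.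

Lemma dotNr u v : dot u (- v) = - dot u v.
Proof. by rewrite !(dotC u) dotNl. Qed.

Lemma dotBr u v w : dot u (v - w) = dot u v - dot u w.
Proof. by rewrite dotDr dotNr. Qed.

Lemma dot_ge0 u : 0 <= dot u u.
Proof. by apply: sumr_ge0 => i _; rewrite -expr2 sqr_ge0. Qed.

Lemma dot_eq0 u : (dot u u == 0) = (u == 0).
Proof.
apply/eqP/eqP => [|->]; last by rewrite /dot big1// => i _; rewrite mxE mul0r.
move=> /eqP; rewrite psumr_eq0 => [/allP u0|i _]; last by rewrite -expr2 sqr_ge0.
apply/rowP => i; have := u0 i (mem_index_enum _).
by rewrite mxE mulf_eq0 orbb => /eqP.
Qed.

Lemma enorm_ge0 u : 0 <= enorm u.
Proof. exact: sqrtr_ge0. Qed.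

Lemma enorm_eq0 u : (enorm u == 0) = (u == 0).
Proof. by rewrite -dot_eq0 sqrtr_eq0 le_eqVlt ltNge dot_ge0 orbF. Qed.

Lemma enorm_gt0 u : (0 < enorm u) = (u != 0).
Proof. by rewrite lt_def enorm_ge0 andbT enorm_eq0. Qed.

Lemma sqr_enorm u : enorm u ^+ 2 = dot u u.
Proof. by rewrite sqr_sqrtr// dot_ge0. Qed.

Lemma enormZ c u : enorm (c *: u) = `|c| * enorm u.
Proof.
by rewrite /enorm dotZl dotZr mulrA -expr2 sqrtrM ?sqr_ge0// sqrtr_sqr.
Qed.

Lemma enormN u : enorm (- u) = enorm u.
Proof. by rewrite -scaleN1r enormZ normrN1 mul1r. Qed.

Lemma enorm_normalize u : u != 0 -> enorm (normalize u) = 1.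
Proof.
move=> u0; rewrite enormZ ger0_norm ?invr_ge0 ?enorm_ge0//.
by rewrite mulVf// enorm_eq0.
Qed.

Lemma enorm_normalize_le1 u : enorm (normalize u) <= 1.
Proof.
have [->|u0] := eqVneq u 0; last by rewrite enorm_normalize.
by rewrite enormZ (eqP (_ : enorm (0 : 'rV[R]_n) == 0)) ?enorm_eq0// mulr0.
Qed.

(** The component of [u] orthogonal to [v]. Every vector of the theorem is a
    positive multiple of one of these: the curvature and the velocity of the
    radial projection, because they are derivatives of normalized vectors, and
    the normal to the cone by construction. *)
Definition perp u v : 'rV[R]_n := u - (dot u v / dot v v) *: v.

Lemma dot_perp u v w : v != 0 ->
  dot (perp u v) (perp w v) = dot u w - dot u v * dot w v / dot v v.
Proof.
rewrite -dot_eq0 => v0; rewrite /perp !(dotBl, dotBr, dotZl, dotZr) (dotC v w).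
by field.
Qed.

Lemma dot_perpl u v w : v != 0 -> dot (perp u v) w = dot (perp u v) (perp w v).
Proof.
by move=> v0; rewrite dot_perp// /perp dotBl dotZl (dotC v w) mulrAC.
Qed.

(** Both sides are the area of the parallelogram spanned by [u] and [v]. *)
Lemma enorm_perpC u v : u != 0 -> v != 0 ->
  enorm (perp u v) * enorm v = enorm (perp v u) * enorm u.
Proof.
move=> u0 v0.
apply/eqP; rewrite -(eqrXn2 (n := 2))// ?mulr_ge0 ?enorm_ge0//; apply/eqP.
rewrite !exprMn !sqr_enorm !dot_perp// (dotC v u).
by move: u0 v0; rewrite -!dot_eq0 => u0 v0; field; rewrite u0.
Qed.

Lemma normr_dot_le u v : `|dot u v| <= enorm u * enorm v.
Proof.
have [->|v0] := eqVneq v 0.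
  by rewrite -[X in dot u X](scale0r 0) dotZr mul0r normr0 mulr_ge0 ?enorm_ge0.
rewrite -ler_sqr ?nnegrE ?normr_ge0 ?mulr_ge0 ?enorm_ge0//.
rewrite exprMn !sqr_enorm real_normK ?num_real//.
have := dot_ge0 (perp u v); rewrite dot_perp// subr_ge0 ler_pdivrMr//.
by rewrite lt_def dot_eq0 v0 dot_ge0.
Qed.

Definition cosine u v : R := dot u v / (enorm u * enorm v).

Lemma cosine_itv u v : -1 <= cosine u v <= 1.
Proof.
rewrite -ler_norml normrM normfV (ger0_norm (mulr_ge0 _ _)) ?enorm_ge0//.
have := normr_dot_le u v; have : 0 <= enorm u * enorm v.
  by rewrite mulr_ge0 ?enorm_ge0.
rewrite le_eqVlt => /predU1P[<-|uv0]; first by rewrite invr0 mulr0 ler01.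
by rewrite ler_pdivrMr// mul1r.
Qed.

Lemma cosine_normalize u v : cosine u v = dot (normalize u) (normalize v).
Proof. by rewrite /cosine /normalize dotZl dotZr invfM mulrC mulrA. Qed.

Lemma sine_perp u v : u != 0 -> v != 0 ->
  Num.sqrt (1 - cosine u v ^+ 2) = enorm (perp u v) / enorm u.
Proof.
move=> u0 v0.
have -> : 1 - cosine u v ^+ 2 = (enorm (perp u v) / enorm u) ^+ 2.
  rewrite /cosine !exprMn exprVn sqr_enorm dot_perp//.
  rewrite exprVn exprMn !sqr_enorm.
  by move: u0 v0; rewrite -!dot_eq0 => u0 v0; field; rewrite u0.
by rewrite sqrtr_sqr ger0_norm// mulr_ge0 ?invr_ge0 ?enorm_ge0.
Qed.

Lemma cosineNr u v : cosine u (- v) = - cosine u v.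
Proof. by rewrite /cosine dotNr enormN mulNr. Qed.

Lemma cosineNl u v : cosine (- u) v = - cosine u v.
Proof. by rewrite /cosine dotNl enormN mulNr. Qed.

Lemma cosineZl c u v : 0 < c -> cosine (c *: u) v = cosine u v.
Proof.
move=> c0; rewrite /cosine dotZl enormZ gtr0_norm//.
by rewrite -(mulrA c (enorm _)) invfM mulrACA divff ?mul1r// gt_eqF.
Qed.

Lemma cosineZr c u v : 0 < c -> cosine u (c *: v) = cosine u v.
Proof.
move=> c0; rewrite /cosine dotZr enormZ gtr0_norm//.
by rewrite (mulrCA _ c) invfM mulrACA divff ?mul1r// gt_eqF.
Qed.

End DotProduct.

Section DotCalculus.
Context {R : realType} {n : nat}.

Lemma cvg_dot {T : Type} {F : set_system T} {FF : Filter F}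
    (f g : T -> 'rV[R]_n) (u v : 'rV[R]_n) :
  f @ F --> u -> g @ F --> v -> dot (f x) (g x) @[x --> F] --> dot u v.
Proof.
move=> fu gv; rewrite /dot; elim: (index_enum _) => [|i r IH].
  by under eq_fun do rewrite big_nil; rewrite big_nil; exact: cvg_cst.
under eq_fun do rewrite big_cons.
rewrite big_cons; apply: cvgD => //; apply: cvgM.
  exact: (cvg_comp _ _ fu (@coord_continuous _ _ _ _ _ _)).
exact: (cvg_comp _ _ gv (@coord_continuous _ _ _ _ _ _)).
Qed.

Lemma cvg_enorm {T : Type} {F : set_system T} {FF : Filter F}
    (f : T -> 'rV[R]_n) (u : 'rV[R]_n) :
  f @ F --> u -> enorm (f x) @[x --> F] --> enorm u.
Proof.
move=> fu; exact: (cvg_comp _ _ (cvg_dot fu fu) (@sqrt_continuous _ _)).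
Qed.

Lemma cvg_perp {T : Type} {F : set_system T} {FF : Filter F}
    (f g : T -> 'rV[R]_n) (u v : 'rV[R]_n) : v != 0 ->
  f @ F --> u -> g @ F --> v -> perp (f x) (g x) @[x --> F] --> perp u v.
Proof.
move=> v0 fu gv; apply: cvgB => //; apply: cvgZ => //; apply: cvgM.
  exact: cvg_dot.
by apply: cvgV; [rewrite dot_eq0|exact: cvg_dot].
Qed.

Lemma cvg_cosine {T : Type} {F : set_system T} {FF : Filter F}
    (f g : T -> 'rV[R]_n) (u v : 'rV[R]_n) : u != 0 -> v != 0 ->
  f @ F --> u -> g @ F --> v -> cosine (f x) (g x) @[x --> F] --> cosine u v.
Proof.
move=> u0 v0 fu gv; apply: cvgM; first exact: cvg_dot.
apply: cvgV; first by rewrite mulf_eq0 !enorm_eq0 negb_or u0.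
by apply: cvgM; exact: cvg_enorm.
Qed.

Lemma is_derive_rowP (f : R -> 'rV[R]_n) (t : R) (df : 'rV[R]_n) :
  is_derive t 1 f df <->
  forall i, is_derive t 1 (fun s => f s ord0 i) (df ord0 i).
Proof.
split=> [[ft <-] i|fi].
  split; first exact: (derivable_mxP _ _ _).1.
  by rewrite (derive_mx ft) mxE.
have ft : derivable f t 1.
  by apply/derivable_mxP => i j; rewrite ord1; have [] := fi j.
split => //; rewrite (derive_mx ft); apply/rowP => i.
by rewrite mxE; have [] := fi i.
Qed.

Lemma is_derive_dot (f g : R -> 'rV[R]_n) (t : R) df dg :
  is_derive t 1 f df -> is_derive t 1 g dg ->
  is_derive t 1 (fun s => dot (f s) (g s)) (dot df (g t) + dot (f t) dg).
Proof.
move=> /is_derive_rowP fi /is_derive_rowP gi.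
have -> : (fun s => dot (f s) (g s)) =
    \sum_(i < n) (fun s => f s ord0 i * g s ord0 i).
  by apply/funext => s; rewrite fct_sumE.
rewrite /dot -big_split; apply: is_derive_sum => i.
have := is_deriveM (fi i) (gi i) => /is_derive_eq; apply.
by rewrite /GRing.scale/= addrC (mulrC (df _ _)).
Qed.

Lemma is_derive_scale (l : R -> R) (f : R -> 'rV[R]_n) (t : R) dl df :
  is_derive t 1 l dl -> is_derive t 1 f df ->
  is_derive t 1 (fun s => l s *: f s) (l t *: df + dl *: f t).
Proof.
move=> lt /is_derive_rowP fi; apply/is_derive_rowP => i.
rewrite (_ : (fun s => _) = l * (fun s => f s ord0 i)); last first.
  by apply/funext => s; rewrite mxE.
have := is_deriveM lt (fi i) => /is_derive_eq; apply.
by rewrite !mxE /GRing.scale/= (mulrC dl).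
Qed.

Lemma is_derive_enorm (f : R -> 'rV[R]_n) (t : R) df :
  f t != 0 -> is_derive t 1 f df ->
  is_derive t 1 (fun s => enorm (f s)) (dot df (f t) / enorm (f t)).
Proof.
move=> f0 ft.
have D0 : 0 < dot (f t) (f t) by rewrite lt_def dot_eq0 f0 dot_ge0.
have := is_derive1_comp (is_derive1_sqrt D0) (is_derive_dot ft ft).
move=> /is_derive_eq; apply.
rewrite (dotC (f t)) -/(enorm _).
have : enorm (f t) != 0 by rewrite enorm_eq0.
by move=> e0; field.
Qed.

Lemma is_derive_normalize (f : R -> 'rV[R]_n) (t : R) df :
  f t != 0 -> is_derive t 1 f df ->
  is_derive t 1 (fun s => normalize (f s)) ((enorm (f t))^-1 *: perp df (f t)).
Proof.
move=> f0 ft; have e0 : enorm (f t) != 0 by rewrite enorm_eq0.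
have := is_derive_scale
  (is_deriveV (f := fun s => enorm (f s)) e0 (is_derive_enorm f0 ft)) ft.
move=> /is_derive_eq; apply.
rewrite /perp scalerBr; congr (_ + _).
rewrite [in RHS]scalerA -scaleNr; congr (_ *: _).
by rewrite -sqr_enorm /GRing.scale/=; field.
Qed.

End DotCalculus.

(** * The fundamental theorem of calculus for an arccosine *)

Section ArcCosine.
Context {R : realType}.
Notation mu := (@lebesgue_measure R).

(** The interesting values of [y] are [1] and [-1]: the curve may be tangent to
    its ray at an end point, and there [acos] is continuous from one side
    only. *)
Lemma cvg_acos {T : Type} {F : set_system T} {FF : Filter F} (f : T -> R)
    (y : R) : (\forall x \near F, -1 <= f x <= 1) -> -1 <= y <= 1 ->
  f @ F --> y -> acos (f x) @[x --> F] --> acos y.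
Proof.
move=> f1 y1 fy.
have cos_within : {within `[0, pi], continuous (@cos R)}.
  by apply: continuous_subspaceT => x; exact: continuous_cos.
have := segment_can_ge_continuous (pi_ge0 R) cos_within (@cosK R).
rewrite cospi cos0 => /subspace_continuousP /(_ y).
rewrite /= in_itv/= => /(_ y1) acosy.
apply: (cvg_comp _ _ _ acosy) => U /= yU.
apply: filterS2 f1 (fy _ yU) => x fx; apply; rewrite /= in_itv/=; exact: fx.
Qed.

(** The fundamental theorem of calculus for [acos \o c] when [c] may reach
    [1] and [-1], possibly on a set as wild as any closed set. There [acos \o c]
    need not be differentiable, but the integrand is [0], because inverting [0]
    gives [0]. The bound on [dc] says that [acos \o c] is Lipschitz. Scaling [c]
    by a factor [l < 1] keeps it away from [1] and [-1], where [acos] is smooth;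
    then [l] tends to [1] under the integral sign by dominated convergence, the
    bound [M] being uniform in [l]. *)
Lemma integral_derive_acos (c dc : R -> R) (M s t : R) : 0 <= M -> s < t ->
  (forall x, x \in `[s, t] -> is_derive x 1 c (dc x)) ->
  {within `[s, t], continuous dc} ->
  (forall x, x \in `[s, t] -> -1 <= c x <= 1) ->
  (forall x, x \in `[s, t] -> `|dc x| <= M * Num.sqrt (1 - c x ^+ 2)) ->
  let k x := dc x / Num.sqrt (1 - c x ^+ 2) in
  mu.-integrable `[s, t] (EFin \o k) /\
  \int[mu]_(x in `[s, t]) k x = acos (c s) - acos (c t).
Proof.
move=> M0 st dcE dc_cont c1 dcM k.
have c_cont : {within `[s, t], continuous c}.
  apply/continuous_in_subspaceT => x /set_mem/= xst.
  by apply/differentiable_continuous/derivable1_diffP; have [] := dcE x xst.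
pose l (m : nat) : R := 1 - harmonic m.
have l01 m : 0 <= l m < 1.
  rewrite /l /harmonic/= subr_ge0 invf_le1 ?ltr0Sn// ler1n/=.
  by rewrite ltrBlDr ltrDl invr_gt0 ltr0Sn.
have l1 : l @ \oo --> (1 : R).
  rewrite -[X in _ --> X]subr0.
  by apply: cvgB; [exact: cvg_cst|exact: cvg_harmonic].
pose S m x := Num.sqrt (1 - (l m * c x) ^+ 2).
pose f m x : R := l m * dc x / S m x.
have sin_le m x : x \in `[s, t] -> 
    l m * Num.sqrt (1 - c x ^+ 2) <= S m x /\ 0 < 1 - (l m * c x) ^+ 2.
  move=> /c1 cx; have /andP[l0 l_lt1] := l01 m.
  have c2 : c x ^+ 2 <= 1 by move/andP: cx => []; nra.
  have l2 : l m ^+ 2 < 1 by rewrite expr_lt1.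
  have lc : (l m * c x) ^+ 2 <= l m ^+ 2.
    by rewrite exprMn ler_piMr ?sqr_ge0.
  split; last by rewrite subr_gt0 (le_lt_trans lc).
  rewrite -[X in X * _](ger0_norm l0) -sqrtr_sqr -sqrtrM ?sqr_ge0//.
  rewrite ler_wsqrtr// mulrBr mulr1 exprMn lerD2r ltW//.
have S_gt0 m x : x \in `[s, t] -> 0 < S m x.
  by move=> /(sin_le m)[_]; rewrite sqrtr_gt0.
have lc_cvg x : l m * c x @[m --> \oo] --> c x.
  by rewrite -[X in _ --> X]mul1r; apply: cvgM => //; exact: cvg_cst.
have S_cvg x : x \in `[s, t] -> S ^~ x @ \oo --> Num.sqrt (1 - c x ^+ 2).
  move=> _; apply: continuous_cvg; first exact: sqrt_continuous.
  apply: cvgB; first exact: cvg_cst.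
  under eq_fun do rewrite expr2.
  by rewrite expr2; apply: cvgM; exact: lc_cvg.
have k_bound x : x \in `[s, t] -> forall m, `|f m x| <= M.
  move=> xst m; rewrite /f normrM normfV (gtr0_norm (S_gt0 m _ xst)).
  rewrite ler_pdivrMr ?S_gt0//.
  have /andP[l0 _] := l01 m; rewrite normrM ger0_norm//.
  have [lS _] := sin_le m _ xst.
  have := ler_wpM2l l0 (dcM _ xst); have := ler_wpM2l M0 lS.
  by rewrite mulrCA => /[swap]; exact: le_trans.
have f_cvg x : x \in `[s, t] -> f ^~ x @ \oo --> k x.
  move=> xst.
  have [s0|s0] := eqVneq (Num.sqrt (1 - c x ^+ 2)) 0.
    have dc0 : dc x = 0.
      by apply/eqP; rewrite -normr_le0 (le_trans (dcM _ xst))// s0 mulr0.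
    rewrite /f /k dc0 mul0r; under eq_fun do rewrite mulr0 mul0r.
    exact: cvg_cst.
  apply: cvgM; last by apply: cvgV => //; exact: S_cvg.
  by rewrite -[X in _ --> X]mul1r; apply: cvgM => //; exact: cvg_cst.
have f_cont m : {within `[s, t], continuous (f m)}.
  move/subspace_continuousP in c_cont; move/subspace_continuousP in dc_cont.
  apply/subspace_continuousP => x xst; apply: cvgM.
    by apply: cvgM; [exact: cvg_cst|exact: dc_cont].
  apply: cvgV; first by rewrite gt_eqF// S_gt0.
  apply: continuous_cvg; first exact: sqrt_continuous.
  apply: cvgB; first exact: cvg_cst.
  under eq_fun do rewrite expr2.
  by rewrite expr2; apply: cvgM; (apply: cvgM; [exact: cvg_cst|exact: c_cont]).
have f_int m : (\int[mu]_(x in `[s, t]) (f m x)%:E =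
    (acos (l m * c s) - acos (l m * c t))%:E)%E.
  have dF x : x \in `[s, t] ->
      is_derive x 1 (fun x => - acos (l m * c x)) (f m x).
    move=> xst; have [_ lc] := sin_le m _ xst.
    have lc1 : -1 < l m * c x < 1.
      by move: lc; rewrite subr_gt0 => lc; apply/andP; split; nra.
    have lcD : is_derive x 1 (fun x => l m * c x) (l m * dc x).
      by have := dcE x xst; exact: is_deriveZ.
    have := is_deriveN (is_derive1_comp (g := fun x => l m * c x)
      (is_derive1_acos lc1) lcD).
    move=> /is_derive_eq; apply.
    by rewrite mulNr opprK mulrC.
  rewrite (@continuous_FTC2 _ (f m) (fun x => - acos (l m * c x)))//.
  - by rewrite -EFinB opprK addrC.
  - have dFc x : x \in `[s, t] ->
        {for x, continuous (fun x => - acos (l m * c x))}.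
      move=> /dF[? _].
      exact/differentiable_continuous/derivable1_diffP.
    split.
    + by move=> x /subset_itv_oo_cc /dF[].
    + apply: cvg_at_right_filter; apply: dFc.
      by rewrite in_itv/= lexx ltW.
    + apply: cvg_at_left_filter; apply: dFc.
      by rewrite in_itv/= lexx ltW.
  - by move=> x /subset_itv_oo_cc /dF[_]; rewrite derive1E.
have mst : measurable (`[s, t] : set (measurableTypeR R)) by [].
have [k_int _ k_cvg] : [/\ mu.-integrable `[s, t] (EFin \o k),
    [sequence (\int[mu]_(x in `[s, t]) `|(EFin \o f m) x - (EFin \o k) x|)%E]_m
      @ \oo --> 0%E &
    [sequence (\int[mu]_(x in `[s, t]) (EFin \o f m) x)%E]_m @ \oo -->
      (\int[mu]_(x in `[s, t]) (EFin \o k) x)%E].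
  apply: (@dominated_convergence _ _ _ mu `[s, t] mst (fun m => EFin \o f m)
    (EFin \o k) (cst M%:E)).
  - move=> m; apply/measurable_EFinP.
    exact: (subspace_continuous_measurable_fun mst (f_cont m)).
  - apply: (emeasurable_fun_cvg (fun m => EFin \o f m)).
      move=> m; apply/measurable_EFinP.
      exact: (subspace_continuous_measurable_fun mst (f_cont m)).
    by move=> x xst; apply: cvg_EFin; [exact: nearW|exact: f_cvg].
  - by apply/nearW => x xst; apply: cvg_EFin; [exact: nearW|exact: f_cvg].
  - apply: measurable_bounded_integrable => //.
    exact: compact_finite_measure (@segment_compact _ _ _).
    exists M; split; first exact: num_real.
    by move=> y My x _ /=; rewrite ger0_norm// ltW.
  - by apply/nearW => x m xst; rewrite /= lee_fin k_bound.
split=> //; rewrite /Rintegral.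
rewrite -[RHS]/(fine (acos (c s) - acos (c t))%:E); congr fine.
apply: (cvg_unique _ k_cvg) => //.
rewrite /=; under eq_fun do rewrite f_int.
apply: cvg_EFin; first exact: nearW.
have acos_cvg x : x \in `[s, t] -> acos (l m * c x) @[m --> \oo] --> acos (c x).
  move=> xst; apply: cvg_acos; [|exact: c1|].
    apply/nearW => m; have [_ lc] := sin_le m _ xst.
    by move: lc; rewrite subr_gt0 => lc; apply/andP; split; nra.
  exact: lc_cvg.
by rewrite /comp/=; apply: cvgB; apply: acos_cvg; rewrite in_itv/= lexx ltW.
Qed.

End ArcCosine.

(** * The angle between an arc and its rays *)

Section ArcGeometry.
Context {R : realType} {n : nat}.
Notation mu := (@lebesgue_measure R).
Context (a : immersed_arc R n) (p : 'rV[R]_n).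

Definition ray (t : R) : 'rV[R]_n := pos a t - p.

Definition acc (t : R) : 'rV[R]_n := derive1 (vel a) t.

Definition ray_cosine (t : R) : R := cosine (vel a t) (ray t).

(** The speed of the radial projection [normalize (ray t)] on the unit sphere
    centered at [p]. *)
Definition angular_speed (t : R) : R :=
  enorm (perp (vel a t) (ray t)) / enorm (ray t).

(** [|k| ds/dt] inside the arc. *)
Definition turning_speed (t : R) : R :=
  enorm (perp (acc t) (vel a t)) / enorm (vel a t).

(** The derivative of the inner product of the two unit vectors along [vel] and
    [ray]; each term comes from differentiating one of them. *)
Definition derive_ray_cosine (t : R) : R :=
  (dot (perp (acc t) (vel a t)) (perp (ray t) (vel a t))
   + dot (perp (vel a t) (ray t)) (perp (vel a t) (ray t)))
  / (enorm (vel a t) * enorm (ray t)).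

Lemma open_itv01 (t : R) : t \in `]0, 1[ -> t \in `[0, 1].
Proof. exact: subset_itv_oo_cc. Qed.

Lemma is_derive_ray (t : R) : t \in `]0, 1[ -> is_derive t 1 ray (vel a t).
Proof.
move=> /(pos_derive a) dpos.
have := is_deriveB dpos (is_derive_cst p t 1) => /is_derive_eq; apply.
by rewrite subr0.
Qed.

Lemma is_derive_vel (t : R) : t \in `]0, 1[ -> is_derive t 1 (vel a) (acc t).
Proof. by move=> /(@vel_derivable _ _ a) dv; rewrite /acc derive1E. Qed.

Lemma curvatureE (t : R) : t \in `]0, 1[ ->
  curvature a t = (enorm (vel a t)) ^- 2 *: perp (acc t) (vel a t).
Proof.
move=> t01; have v0 := vel_neq0 a (open_itv01 t01).
rewrite /curvature derive1E /speed.
have [_ ->] := is_derive_normalize v0 (is_derive_vel t01).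
by rewrite scalerA -expr2 exprVn.
Qed.

Lemma nuCE (t : R) : t \in `[0, 1] ->
  nuC a p t = normalize (perp (ray t) (vel a t)).
Proof.
move=> t01; have v0 := vel_neq0 a t01.
rewrite /nuC /= -/(ray t); congr normalize.
rewrite /perp /tangent /normalize dotZr scalerA -sqr_enorm.
by congr (_ - _ *: _); rewrite mulrAC mulrC expr2 invfM mulrA.
Qed.

Lemma cvg_vel (t : R) : t \in `[0, 1] ->
  vel a x @[x --> within `[0, 1] (nbhs t)] --> vel a t.
Proof. by move: t; exact/subspace_continuousP/vel_continuous. Qed.

Lemma cvg_ray (t : R) : t \in `[0, 1] ->
  ray x @[x --> within `[0, 1] (nbhs t)] --> ray t.
Proof.
move=> t01; apply: cvgB; last exact: cvg_cst.
by move: t t01; exact/subspace_continuousP/pos_continuous.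
Qed.

Lemma cvg_acc (t : R) : t \in `]0, 1[ -> acc x @[x --> t] --> acc t.
Proof. by move=> /(@acc_continuous _ _ a). Qed.

Lemma near_itv01 (t : R) : t \in `]0, 1[ -> nbhs t = within `[0, 1] (nbhs t).
Proof.
move=> t01; rewrite within_interior//.
by apply: filterS (near_in_itvoo t01) => x; exact: open_itv01.
Qed.

Lemma curvature_speedE (t : R) : t \in `]0, 1[ ->
  enorm (curvature a t) * speed a t = turning_speed t.
Proof.
move=> t01; have := vel_neq0 a (open_itv01 t01); rewrite -enorm_eq0 => v0.
rewrite curvatureE// enormZ ger0_norm ?invr_ge0 ?exprn_ge0 ?enorm_ge0//.
by rewrite /speed /turning_speed; field.
Qed.

Lemma turning_speed_continuous (t : R) : t \in `]0, 1[ ->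
  {for t, continuous turning_speed}.
Proof.
move=> t01; have v0 := vel_neq0 a (open_itv01 t01).
have cv : vel a @ t --> vel a t.
  by rewrite {1}near_itv01//; exact/cvg_vel/open_itv01.
apply: cvgM; first by apply: cvg_enorm; apply: cvg_perp => //; exact: cvg_acc.
by apply: cvgV; [rewrite enorm_eq0|exact: cvg_enorm].
Qed.

Context (p_off : {in `[0, 1], forall t, pos a t != p}).

Lemma ray_neq0 (t : R) : t \in `[0, 1] -> ray t != 0.
Proof. by move=> /p_off; rewrite subr_eq0. Qed.

Lemma ray_cosine_continuous : {within `[0, 1], continuous ray_cosine}.
Proof.
apply/subspace_continuousP => t t01; apply: cvg_cosine.
- exact: vel_neq0.
- exact: ray_neq0.
- exact: cvg_vel.
- exact: cvg_ray.
Qed.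

Lemma acos_ray_cosine_continuous :
  {within `[0, 1], continuous (fun t => acos (ray_cosine t))}.
Proof.
apply/subspace_continuousP => t t01; apply: cvg_acos.
- by apply/nearW => x; exact: cosine_itv.
- exact: cosine_itv.
- by move: t t01; exact/subspace_continuousP/ray_cosine_continuous.
Qed.

Lemma angular_speed_continuous : {within `[0, 1], continuous angular_speed}.
Proof.
apply/subspace_continuousP => t t01; have w0 := ray_neq0 t01.
apply: cvgM; last by apply: cvgV; [rewrite enorm_eq0|exact/cvg_enorm/cvg_ray].
by apply: cvg_enorm; apply: cvg_perp => //; [exact: cvg_vel|exact: cvg_ray].
Qed.

Lemma is_derive_ray_cosine (t : R) : t \in `]0, 1[ ->
  is_derive t 1 ray_cosine (derive_ray_cosine t).
Proof.
move=> t01; have v0 := vel_neq0 a (open_itv01 t01).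
have w0 := ray_neq0 (open_itv01 t01).
have -> : ray_cosine = (fun s => dot (normalize (vel a s)) (normalize (ray s))).
  by apply/funext => s; rewrite /ray_cosine cosine_normalize.
have := is_derive_dot (is_derive_normalize v0 (is_derive_vel t01))
  (is_derive_normalize w0 (is_derive_ray t01)).
move=> /is_derive_eq; apply.
rewrite /derive_ray_cosine /normalize !dotZl !dotZr dot_perpl//.
rewrite (dotC (vel a t)) (@dot_perpl _ _ _ (ray t) (vel a t))//.
move: v0 w0; rewrite -!enorm_eq0 => v0 w0; field.
by rewrite w0.
Qed.

Lemma derive_ray_cosine_continuous (t : R) : t \in `]0, 1[ ->
  {for t, continuous derive_ray_cosine}.
Proof.
move=> t01; have v0 := vel_neq0 a (open_itv01 t01).
have w0 := ray_neq0 (open_itv01 t01).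
have cv : vel a @ t --> vel a t.
  by rewrite {1}near_itv01//; exact/cvg_vel/open_itv01.
have cw : ray @ t --> ray t.
  by rewrite {1}near_itv01//; exact/cvg_ray/open_itv01.
have ca := cvg_acc t01.
apply: cvgM.
  by apply: cvgD; apply: cvg_dot; exact: cvg_perp.
apply: cvgV; first by rewrite mulf_eq0 !enorm_eq0 negb_or v0.
by apply: cvgM; exact: cvg_enorm.
Qed.

Definition normal_curvature_speed (t : R) : R :=
  dot (curvature a t) (nuC a p t) * speed a t.

Lemma normal_curvature_speedE (t : R) : t \in `]0, 1[ ->
  normal_curvature_speed t =
  dot (perp (acc t) (vel a t)) (perp (ray t) (vel a t))
  / (enorm (vel a t) * enorm (perp (ray t) (vel a t))).
Proof.
move=> t01; have := vel_neq0 a (open_itv01 t01); rewrite -enorm_eq0 => v0.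
rewrite /normal_curvature_speed curvatureE// nuCE ?open_itv01//.
rewrite /normalize dotZl dotZr /speed [in RHS]invfM.
by move: (enorm (perp (ray t) _))^-1 => z; field.
Qed.

Lemma normal_curvature_speed_le (t : R) : t \in `]0, 1[ ->
  `|normal_curvature_speed t| <= turning_speed t.
Proof.
move=> t01; rewrite -curvature_speedE// normrM.
rewrite [X in _ * X <= _]ger0_norm ?enorm_ge0//.
rewrite ler_wpM2r ?enorm_ge0// (le_trans (normr_dot_le _ _))//.
by rewrite ler_piMr ?enorm_ge0// enorm_normalize_le1.
Qed.

(** The differential identity behind the theorem. With [phi] the angle between
    [vel] and [ray], so that [ray_cosine] is [cos phi], the first equation reads
    [- phi' = k . nuC ds/dt + angular_speed] where [sin phi] is nonzero. Where
    [sin phi = 0] the ray is tangent to the arc, and both sides are [0]: [nuC] is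
    [0] there and so is the inverse of [sin phi]. The second equation bounds the
    derivative of [cos phi] by a multiple of [sin phi]. *)
Lemma derive_ray_cosineE (t : R) : t \in `]0, 1[ ->
  derive_ray_cosine t / Num.sqrt (1 - ray_cosine t ^+ 2) =
    normal_curvature_speed t + angular_speed t /\
  derive_ray_cosine t = (normal_curvature_speed t + angular_speed t)
    * Num.sqrt (1 - ray_cosine t ^+ 2).
Proof.
move=> t01; have v0 := vel_neq0 a (open_itv01 t01).
have w0 := ray_neq0 (open_itv01 t01).
rewrite normal_curvature_speedE// /ray_cosine sine_perp//.
rewrite /derive_ray_cosine /angular_speed.
have := enorm_perpC v0 w0.
move: v0 w0; rewrite -!enorm_eq0 -(sqr_enorm (perp (vel a t) _)).
set v := enorm (vel a t); set w := enorm (ray t).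
set y := enorm (perp (vel a t) (ray t)); set z := enorm (perp (ray t) (vel a t)).
set d := dot _ _ => v0 w0 yz.
have [z0|z0] := eqVneq z 0.
  have y0 : y = 0.
    by move/eqP: yz; rewrite z0 mul0r mulf_eq0 (negbTE w0) orbF => /eqP.
  have d0 : d = 0.
    rewrite /d; move/eqP : z0; rewrite /z enorm_eq0 => /eqP->.
    by rewrite -[X in dot _ X](scale0r 0) dotZr mul0r.
  by rewrite y0 d0 expr0n/= !(mul0r, add0r, addr0, mulr0).
have -> : y = z * v / w by rewrite -yz mulfK.
by split; field; rewrite ?v0 ?w0 ?z0.
Qed.

End ArcGeometry.

(** * Integration along an arc *)

Section ArcIntegrals.
Context {R : realType} {n : nat}.
Notation mu := (@lebesgue_measure R).
Context (a : immersed_arc R n) (p : 'rV[R]_n).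
Context (p_off : {in `[0, 1], forall t, pos a t != p}).

(** The length of the radial projection of the arc up to parameter [t]. *)
Definition swept_angle (t : R) : R :=
  \int[mu]_(x in `[0, t]) angular_speed a p x.

Lemma integrable_angular_speed :
  mu.-integrable `[0, 1] (EFin \o angular_speed a p).
Proof.
apply: continuous_compact_integrable; first exact: segment_compact.
exact: angular_speed_continuous.
Qed.

Lemma swept_angle_continuous : {within `[0, 1], continuous swept_angle}.
Proof.
exact: (parameterized_integral_continuous ler01 integrable_angular_speed).
Qed.

Lemma swept_angle0 : swept_angle 0 = 0.
Proof. by rewrite /swept_angle set_itv1 Rintegral_set1. Qed.

Lemma integrable_angular_speed_sub (s t : R) : 0 <= s -> t <= 1 ->
  mu.-integrable `[s, t] (EFin \o angular_speed a p).
Proof.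
move=> s0 t1; apply: integrableS integrable_angular_speed => // x /=.
by rewrite !in_itv/= => /andP[sx xt]; rewrite (le_trans s0)// (le_trans xt).
Qed.

Lemma integral_angular_speed (s t : R) : 0 <= s -> s < t -> t <= 1 ->
  \int[mu]_(x in `[s, t]) angular_speed a p x = swept_angle t - swept_angle s.
Proof.
move=> s0 st t1; rewrite /swept_angle Rintegral_itvB ?bnd_simp ?(ltW st)//.
  rewrite -Rintegral_itv_obnd_cbnd//.
  apply: integrableS (integrable_angular_speed_sub s0 t1) => //.
  exact: subset_itv_oc_cc.
exact: integrable_angular_speed_sub.
Qed.

(** The identity of [derive_ray_cosineE] integrated over a compact subarc. The
    end points must be avoided: the acceleration can be unbounded near them, and
    so the constant [B z] below need not exist on the whole arc. *)
Lemma integral_normal_curvature (s t : R) : 0 < s -> s < t -> t < 1 ->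
  mu.-integrable `[s, t] (EFin \o normal_curvature_speed a p) /\
  subarc_integral a (fun x => dot (curvature a x) (nuC a p x)) (s, t) =
    acos (ray_cosine a p s) - acos (ray_cosine a p t)
    - (swept_angle t - swept_angle s).
Proof.
move=> s0 st t1.
have sub01 x : x \in `[s, t] -> x \in `]0, 1[.
  rewrite !in_itv/= => /andP[sx xt].
  by rewrite (lt_le_trans s0)//= (le_lt_trans xt).
pose B x := turning_speed a x + angular_speed a p x.
have B_ge0 x : 0 <= B x by rewrite addr_ge0// mulr_ge0 ?invr_ge0 ?enorm_ge0.
have B_cont : {within `[s, t], continuous B}.
  apply: within_continuousD.
    apply: continuous_in_subspaceT => x /set_mem/= /sub01.
    exact: turning_speed_continuous.
  apply: continuous_subspaceW (angular_speed_continuous p_off) => x.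
  by move=> /sub01/open_itv01.
have [z zst Bz] := EVT_max (ltW st) B_cont.
have dcB x : x \in `[s, t] -> `|derive_ray_cosine a p x| <=
    B z * Num.sqrt (1 - ray_cosine a p x ^+ 2).
  move=> xst; have [_ ->] := derive_ray_cosineE p_off (sub01 x xst).
  rewrite normrM [X in _ * X <= _]ger0_norm ?sqrtr_ge0//.
  rewrite ler_wpM2r ?sqrtr_ge0// (le_trans _ (Bz _ xst))//.
  rewrite (le_trans (ler_normD _ _))// lerD//.
    exact: normal_curvature_speed_le (sub01 x xst).
  by rewrite ger0_norm// mulr_ge0 ?invr_ge0 ?enorm_ge0.
have dc_cont : {within `[s, t], continuous (derive_ray_cosine a p)}.
  apply: continuous_in_subspaceT => x /set_mem/= /sub01.
  exact: derive_ray_cosine_continuous.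
have [] := integral_derive_acos (B_ge0 z) st
  (fun x xst => is_derive_ray_cosine p_off (sub01 x xst)) dc_cont
  (fun x _ => cosine_itv _ _) dcB.
set k := fun x : R => _ / _.
have kE x : x \in `[s, t] ->
    k x = normal_curvature_speed a p x + angular_speed a p x.
  by move=> /sub01 /(derive_ray_cosineE p_off)[].
move=> k_int k_eq.
have mst : measurable (`[s, t] : set (measurableTypeR R)) by [].
have w_int := integrable_angular_speed_sub (ltW s0) (ltW t1).
have NE x : x \in `[s, t] ->
    normal_curvature_speed a p x = k x - angular_speed a p x.
  by move=> /kE ->; rewrite addrK.
split.
  have := integrableB mst k_int w_int.
  apply: eq_integrable => // x /set_mem/= xst.
  by rewrite NE// EFinB.
rewrite /subarc_integral/=.
under eq_Rintegral => x /set_mem/= xst do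
  rewrite -/(normal_curvature_speed a p x) NE//.
rewrite RintegralB// k_eq integral_angular_speed//; exact: ltW.
Qed.

#[local] Instance arc_ends_filter : ProperFilter (@arc_ends R).
Proof. exact: filter_prod_proper. Qed.

Lemma cvg_arc_ends_fst (f : R -> R) : {within `[0, 1], continuous f} ->
  f I.1 @[I --> arc_ends] --> f 0.
Proof.
move=> /(continuous_within_itvP _ ltr01)[_ f0 _].
exact: (cvg_comp _ _ cvg_fst f0).
Qed.

Lemma cvg_arc_ends_snd (f : R -> R) : {within `[0, 1], continuous f} ->
  f I.2 @[I --> arc_ends] --> f 1.
Proof.
move=> /(continuous_within_itvP _ ltr01)[_ _ f1].
exact: (cvg_comp _ _ cvg_snd f1).
Qed.

Lemma near_arc_ends :
  \forall I \near @arc_ends R, [/\ 0 < I.1, I.1 < I.2 & I.2 < 1].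
Proof.
have h0 : (0 : R) < 2^-1 by rewrite invr_gt0.
have h1 : 2^-1 < 1 :> R by rewrite invf_lt1 ?ltr1n.
have n1 : \forall x \near (0 : R)^'+, 0 < x < 2^-1.
  near=> x; apply/andP; split; near: x.
    exact: nbhs_right_gt.
  exact: nbhs_right_lt.
have n2 : \forall x \near (1 : R)^'-, 2^-1 < x < 1.
  near=> x; apply/andP; split; near: x.
    exact: nbhs_left_gt.
  exact: nbhs_left_lt.
exists ([set x | 0 < x < 2^-1], [set x | 2^-1 < x < 1]); first by split.
move=> [s t] [/= /andP[s0 s1] /andP[t0 t1]].
by split=> //; exact: lt_trans t0.
Unshelve. all: by end_near. Qed.

(** Only [acos (ray_cosine)] and [swept_angle] remain after integrating over a
    subarc, and these are continuous up to the end points even where the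
    curvature is not integrable. *)
Lemma arc_integral_cvg :
  subarc_integral a (fun x => dot (curvature a x) (nuC a p x)) @ arc_ends -->
  acos (ray_cosine a p 0) - acos (ray_cosine a p 1) - swept_angle 1.
Proof.
have phi_cont := acos_ray_cosine_continuous p_off.
have -> : swept_angle 1 = swept_angle 1 - swept_angle 0.
  by rewrite swept_angle0 subr0.
have lim_eq : {near arc_ends, (fun I : R * R =>
      acos (ray_cosine a p I.1) - acos (ray_cosine a p I.2)
      - (swept_angle I.2 - swept_angle I.1)) =1
    subarc_integral a (fun x => dot (curvature a x) (nuC a p x))}.
  apply: (@filterS _ (@arc_ends R) _ _ _ _ near_arc_ends) => -[s t].
  move=> /= [s0 st t1].
  by have [_ ->] := integral_normal_curvature s0 st t1.
apply: cvg_trans (near_eq_cvg lim_eq) _.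
apply: cvgB; apply: cvgB.
- exact: (cvg_arc_ends_fst phi_cont).
- exact: (cvg_arc_ends_snd phi_cont).
- exact: (cvg_arc_ends_snd swept_angle_continuous).
- exact: (cvg_arc_ends_fst swept_angle_continuous).
Qed.

(** At the first end point the segment to [p] points opposite to [ray], and at
    the second one the end tangent points opposite to [vel] as well; this is
    where the signs of the two terms come from. *)
Lemma sum_beta : \sum_(j : bool) (pi / 2 - beta a p j) =
  acos (ray_cosine a p 0) - acos (ray_cosine a p 1).
Proof.
have i0 : (0 : R) \in `[0, 1] by rewrite in_itv/= lexx ler01.
have i1 : (1 : R) \in `[0, 1] by rewrite in_itv/= lexx ler01.
have betaE j : beta a p j = if j then acos (ray_cosine a p 1)
    else pi - acos (ray_cosine a p 0).
  rewrite /beta /angle -/(cosine _ _) -opprB cosineNr /end_tangent /arc_end.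
  case: j.
    rewrite cosineNl opprK /tangent /normalize cosineZl//.
    by rewrite invr_gt0 enorm_gt0 vel_neq0.
  rewrite /tangent /normalize cosineZl ?invr_gt0 ?enorm_gt0 ?vel_neq0//.
  by rewrite acosN// cosine_itv.
rewrite big_bool/= !betaE.
by field.
Qed.

(** A sphere smaller than the distance from [p] to the arc meets the segment
    from [p] to every point of the arc, so that the slice is the whole radial
    projection, scaled by [eps]. *)
Lemma slice_lengthE : \forall eps \near 0^'+,
  slice_length a p eps = eps * swept_angle 1.
Proof.
have ray_cont : {within `[0, 1], continuous (fun t => enorm (ray a p t))}.
  by apply/subspace_continuousP => t t01; exact/cvg_enorm/cvg_ray.
have [z z01 zmin] := EVT_min ler01 ray_cont.
have rz0 : 0 < enorm (ray a p z) by rewrite enorm_gt0 ray_neq0.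
near=> eps.
have eps0 : 0 < eps by near: eps; exact: nbhs_right_gt.
have eps_lt : eps < enorm (ray a p z) by near: eps; exact: nbhs_right_lt.
have dom : slice_domain a p eps = `]0, 1[%classic.
  apply/seteqP; split=> [t /andP[]//|t /= t01].
  rewrite /slice_domain/= t01/= /slice_param.
  have t01' := open_itv01 t01.
  rewrite ler_pdivrMr ?enorm_gt0 ?ray_neq0// mul1r.
  exact: le_trans (ltW eps_lt) (zmin _ t01').
have speedE t : t \in `]0, 1[ ->
    enorm (derive1 (slice a p eps) t) = eps * angular_speed a p t.
  move=> t01; have w0 := ray_neq0 p_off (open_itv01 t01).
  have sE : slice a p eps = (cst p + eps \*: (fun t => normalize (ray a p t))).
    apply/funext => x.
    by rewrite -[RHS]/(p + eps *: (_^-1 *: ray a p x)) scalerA.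
  have := is_deriveD (is_derive_cst p t 1)
    (is_deriveZ eps (is_derive_normalize w0 (is_derive_ray a p t01))).
  rewrite derive1E sE => -[_ ->]; rewrite add0r !enormZ gtr0_norm//.
  rewrite ger0_norm ?invr_ge0 ?enorm_ge0//.
  by rewrite /angular_speed (mulrC _^-1).
rewrite /slice_length dom.
under eq_Rintegral => t /set_mem/= t01 do rewrite speedE//.
have w_int : mu.-integrable `]0, 1[ (EFin \o angular_speed a p).
  apply: integrableS integrable_angular_speed => //.
  exact: subset_itv_oo_cc.
rewrite RintegralZl//; congr (_ * _).
rewrite /swept_angle /Rintegral [in RHS]integral_itv_bndoo//.
exact: (measurable_int mu w_int).
Unshelve. all: by end_near. Qed.

Lemma measurable_turning_speed :
  measurable_fun (`]0, 1[ : set R) (turning_speed a).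
Proof.
apply: open_continuous_measurable_fun; first exact: interval_open.
by move=> t /set_mem; exact: turning_speed_continuous.
Qed.

(** The bound holds on compact subarcs, where [|k . nuC| <= |k|], and passes to
    the limit. The right-hand side may be infinite. *)
Lemma opp_arc_integral_le :
  ((- arc_integral a (fun x => dot (curvature a x) (nuC a p x)))%:E <=
   \int[mu]_(t in `]0%R, 1%R[) (turning_speed a t)%:E)%E.
Proof.
have ts_ge0 t : 0 <= turning_speed a t.
  by rewrite mulr_ge0 ?invr_ge0 ?enorm_ge0.
have mts := measurable_turning_speed.
have cvgN := @cvgN _ _ _ _ arc_ends_filter _ _ arc_integral_cvg.
have -> : arc_integral a (fun x => dot (curvature a x) (nuC a p x)) =
    acos (ray_cosine a p 0) - acos (ray_cosine a p 1) - swept_angle 1.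
  by apply/cvg_lim => //; exact: arc_integral_cvg.
set I01 := (X in (_ <= X)%E).
have sub_le (s t : R) : 0 < s -> s < t -> t < 1 ->
    ((- subarc_integral a (fun x => dot (curvature a x) (nuC a p x)) (s, t))%:E
     <= I01)%E.
  move=> s0 st t1.
  have [N_int _] := integral_normal_curvature s0 st t1.
  have st01 : `[s, t] `<=` `]0, 1[.
    move=> x /=; rewrite !in_itv/= => /andP[sx xt].
    by rewrite (lt_le_trans s0)//= (le_lt_trans xt).
  apply: (@le_trans _ _ (\int[mu]_(x in `[s, t]) (turning_speed a x)%:E)%E).
    rewrite /subarc_integral/= EFinN /Rintegral fineK; last first.
      exact: integrable_fin_num.
    have mN := measurable_int _ N_int.
    rewrite (le_trans (lee_abs _))// abseN (le_trans (le_abse_integral _ _ _))//.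
    apply: ge0_le_integral => //.
    - exact: (measurableT_comp (@abse_measurable _ setT) mN).
    - apply/measurable_EFinP; exact: measurable_funS mts.
    - by move=> x xst; rewrite lee_fin normal_curvature_speed_le//; exact: st01.
  apply: ge0_subset_integral => //; first exact/measurable_EFinP.
  by move=> x _; rewrite lee_fin.
case I01E : I01 => [r| |]; [|by rewrite leey|].
- rewrite I01E in sub_le.
  rewrite lee_fin -(cvg_lim _ cvgN)//; apply: limr_le.
    by apply/cvg_ex; eexists; exact: cvgN.
  apply: (@filterS _ (@arc_ends R) _ _ _ _ near_arc_ends) => -[s t].
  by move=> [s0 st t1]; rewrite -lee_fin sub_le.
- have : (0 <= I01)%E by apply: integral_ge0 => x _; rewrite lee_fin.
  by rewrite I01E.
Qed.

End ArcIntegrals.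

(** * Vertices and the cone density *)

Section Vertices.
Context {R : realType} {n N : nat}.
Notation mu := (@lebesgue_measure R).
Context (a : 'I_N -> immersed_arc R n) (p : 'rV[R]_n).

(** An immersion is injective near each parameter, as its velocity does not
    vanish: every point of a fiber is isolated in it. *)
Lemma countable_fiber (b : immersed_arc R n) (q : 'rV[R]_n) :
  countable [set t | (t \in `]0, 1[) && (pos b t == q)].
Proof.
set S := [set t | _]; apply: sub_countable (countable_isolated S).
apply: subset_card_le => t /= /andP[t01 /eqP posq].
split; first by rewrite inE; apply/andP; split=> //; exact/eqP.
have [dpos velE] := pos_derive b t01.
have : h^-1 *: (pos b (h *: 1 + t) - pos b t) @[h --> 0^'] --> vel b t.
  by rewrite -velE; exact: dpos.
move=> /cvgr_neq0 /(_ (vel_neq0 b (open_itv01 t01))).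
move=> /nbhs_ballP[e /= e0 he].
exists (ball t e); first exact: nbhsx_ballx.
apply/seteqP; split=> [x [tx /andP[_ /eqP posx]]|x ->]; last first.
  by split; [exact: ballxx|apply/andP; split=> //; exact/eqP].
apply/eqP/negPn/negP => xt.
have /he : ball (0 : R) e (x - t).
  by move: tx; rewrite /ball/= sub0r normrN distrC.
rewrite /= subr_eq0 => /(_ xt).
have -> : (x - t) *: (1 : R) + t = x by rewrite /GRing.scale/= mulr1 subrK.
by rewrite posx posq subrr scaler0 eqxx.
Qed.

Lemma countable_vertex_params k :
  countable [set t | (t \in `]0, 1[) && (pos (a k) t \in vertices a)].
Proof.
apply: (@sub_countable _ _ _
  (\bigcup_(q in [set` vertices a])
     [set t | (t \in `]0, 1[) && (pos (a k) t == q)])).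
  by apply: subset_card_le => t /= /andP[t01 tq]; exists (pos (a k) t) => //=;
    rewrite t01 eqxx.
apply: bigcup_countable; first exact/finite_set_countable/finite_seq.
by move=> q _; exact: countable_fiber.
Qed.

(** An arc may run through vertices in its interior. The total curvature leaves
    these parameters out, at no cost since they are countably many. *)
Lemma integral_regular_part k :
  (\int[mu]_(t in regular_part a k)
      (enorm (curvature (a k) t) * speed (a k) t)%:E =
   \int[mu]_(t in `]0%R, 1%R[) (turning_speed (a k) t)%:E)%E.
Proof.
set V := [set t | (t \in `]0, 1[) && (pos (a k) t \in vertices a)].
have V0 : mu V = 0%E.
  exact/countable_lebesgue_measure0/countable_vertex_params.
have mV : measurable (V : set (measurableTypeR R)).
  by apply: countable_measurable => //; exact: countable_vertex_params.
have -> : regular_part a k = `]0, 1[ `\` V.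
  apply/seteqP; split=> t /=.
    by move=> /andP[t01 tV]; split=> //; rewrite /V/= (negbTE tV) andbF.
  move=> [t01 tV]; rewrite /regular_part/= t01.
  by apply/negP => ?; apply: tV; rewrite /V/= t01.
rewrite [RHS](ge0_negligible_integral mV)//; last 2 first.
- by apply/measurable_EFinP; exact: (measurable_turning_speed (a k)).
- by move=> t _; rewrite lee_fin mulr_ge0 ?invr_ge0 ?enorm_ge0.
by apply: eq_integral => t /set_mem[/= t01 _]; rewrite curvature_speedE.
Qed.

(** The total curvature at [q] is a supremum over directions; the direction from
    [q] to [p] gives the left-hand side. *)
Lemma le_tc (q : 'rV[R]_n) : q != p ->
  \sum_(i | endpoint a i == q) (pi / 2 - beta (a i.1) p i.2) <= tc a q.
Proof.
move=> qp; have pq0 : p - q != 0 by rewrite subr_eq0 eq_sym.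
apply: ub_le_sup.
  exists (\sum_(i | endpoint a i == q) (pi / 2)) => _ /= [e _ <-].
  apply: ler_sum => i _; rewrite gerBl /angle acos_ge0// cosine_itv//.
exists (normalize (p - q)) => /=; first exact: enorm_normalize.
apply: eq_bigr => i /eqP iq; rewrite /beta -/(endpoint a i) iq /angle.
by rewrite -!/(cosine _ _) /normalize cosineZr// invr_gt0 enorm_gt0.
Qed.

Context (p_off : forall k, {in `[0, 1], forall t, pos (a k) t != p}).

Lemma sum_beta_le_sum_tc :
  \sum_(k < N) \sum_(j : bool) (pi / 2 - beta (a k) p j) <=
  \sum_(q <- vertices a) tc a q.
Proof.
apply: (@le_trans _ _ (\sum_(q <- vertices a)
    \sum_(i | endpoint a i == q) (pi / 2 - beta (a i.1) p i.2))); last first.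
  rewrite big_seq [leRHS]big_seq; apply: ler_sum => q.
  rewrite mem_undup => /mapP[[k j] _ ->]; apply: le_tc.
  by apply: p_off; case: j; rewrite in_itv/= ?lexx ler01.
(* Each end of an arc lies at exactly one vertex. *)
rewrite pair_bigA (exchange_big_dep predT)//=; apply: ler_sum => i _.
rewrite -big_filter (eq_filter (a2 := pred1 (endpoint a i))); last first.
  by move=> q; rewrite /= eq_sym.
rewrite filter_pred1_uniq ?undup_uniq ?big_seq1//.
by rewrite mem_undup; apply: map_f; rewrite mem_enum.
Qed.

Lemma cone_density_cvg : cone_density_ratio a p @ 0^'+ -->
  (\sum_(k < N) swept_angle (a k) p 1) / (2 * pi).
Proof.
have ratioE : {near 0^'+,
    (fun=> (\sum_(k < N) swept_angle (a k) p 1) / (2 * pi))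
    =1 cone_density_ratio a p}.
  near=> eps; rewrite /cone_density_ratio.
  have eps0 : 0 < eps by near: eps; exact: nbhs_right_gt.
  rewrite [in RHS](eq_bigr (fun k => eps * swept_angle (a k) p 1)); last first.
    move=> k _; move: k; near: eps; apply: filter_forall => k.
    exact: slice_lengthE (p_off k).
  rewrite -mulr_sumr.
  have : (pi : R) != 0 by rewrite lt0r_neq0// pi_gt0.
  by move: (pi : R) => c c0; field; rewrite c0 lt0r_neq0.
exact: cvg_trans (near_eq_cvg ratioE) (cvg_cst _).
Unshelve. all: by end_near. Qed.

End Vertices.

(** * The density formula and its bound by total curvature *)

Theorem theorem2 (R : realType) (n N : nat) (a : 'I_N -> immersed_arc R n)
    (ha : is_graph a) (p : 'rV[R]_n) (hp : ~ graph_support a p) :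
  [/\ cvg (cone_density_ratio a p @ 0^'+),
      (forall k : 'I_N, arc_integrable (a k)
         (fun t => dot (curvature (a k) t) (nuC (a k) p t))),
      2 * pi * cone_density a p =
        - (\sum_(k < N) arc_integral (a k)
             (fun t => dot (curvature (a k) t) (nuC (a k) p t)))
        + \sum_(k < N) \sum_(j : bool) (pi / 2 - beta (a k) p j)
    & ((- (\sum_(k < N) arc_integral (a k)
             (fun t => dot (curvature (a k) t) (nuC (a k) p t)))
        + \sum_(k < N) \sum_(j : bool) (pi / 2 - beta (a k) p j))%:E
       <= total_curvature a)%E].
Proof.
have p_off k : {in `[0, 1], forall t, pos (a k) t != p}.
  by move=> t t01; apply/negP => /eqP tp; apply: hp; exists k, t.
have density_cvg := cone_density_cvg p_off.
split.
- by apply/cvg_ex; eexists; exact: density_cvg.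
- by move=> k; apply/cvg_ex; eexists; exact: arc_integral_cvg.
- rewrite /cone_density (cvg_lim _ density_cvg)// mulrC divfK; last first.
    by rewrite mulf_neq0 ?gt_eqF ?pi_gt0.
  rewrite addrC -sumrB; apply: eq_bigr => k _.
  rewrite sum_beta// /arc_integral (cvg_lim _ (arc_integral_cvg (p_off k)))//.
  by rewrite subKr.
- rewrite /total_curvature EFinD leeD//; last first.
    by rewrite lee_fin; exact: sum_beta_le_sum_tc.
  rewrite -sumrN -sumEFin; apply: lee_sum => k _.
  by rewrite integral_regular_part; exact: opp_arc_integral_le.
Qed.
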